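(* Let $d\ge 2$, and let $b=b(n)\to\infty$ and $k=k(n)\to\infty$ (as $n\to\infty$) be sequences of positive integers with $b\ge k$ and $n/(bk)\to 0$. There exists no estimator $V_n\in\mathcal{H}_{d,b}^k$ such that, for all $\varepsilon>0$, the following limit holds: $$\sup_{p\in\mathcal{D}_d}P\left(\|V_n-p\|_1>3\min_{q\in\mathcal{H}_{d,b}^k}\|p-q\|_1+\varepsilon\right)\to 0\quad(n\to\infty),$$ where $V_n$ is a function of $X_1,\ldots,X_n\overset{iid}{\sim}p$.
   Context: $[b]=\{1,\ldots,b\}$. $\mathcal{D}_d$ is the set of all probability densities on $[0,1)^d$ (with respect to $d$-dimensional Lebesgue measure); $\|\cdot\|_1$ is the $L^1$ norm. $\Delta_k$ is the set of vectors in $\mathbb{R}^k$ with nonnegative entries summing to one. For $i\in[b]$, let $h_{1,b,i}(x)=b\,\mathbf{1}\left(\frac{i-1}{b}\le x<\frac{i}{b}\right)$ on $[0,1)$, and let $\mathcal{H}_{1,b}$ be the convex hull of $\{h_{1,b,i}: i\in[b]\}$. For univariate functions, $\prod_{j=1}^d p_j$ denotes $(x_1,\ldots,x_d)\mapsto\prod_{j=1}^d p_j(x_j)$. The set of multi-view histograms is $$\mathcal{H}_{d,b}^k=\left\{\sum_{i=1}^k w_i\prod_{j=1}^d p_{i,j}\;:\; w\in\Delta_k,\ p_{i,j}\in\mathcal{H}_{1,b}\right\}.$$ An estimator $V_n\in\mathcal{H}_{d,b}^k$ is (for each $n$) a function of the sample, not depending on $p$, with values in $\mathcal{H}_{d,b}^k$.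 *)

(* Defs.v *)
From HB Require Import structures.
From mathcomp Require Import all_boot all_order all_algebra.
From mathcomp Require Import all_classical all_reals all_analysis.
From mathcomp Require Import measurable_realfun.

Set Implicit Arguments.
Unset Strict Implicit.
Unset Printing Implicit Defensive.

Import Order.TTheory GRing.Theory Num.Theory.
Import numFieldNormedType.Exports.

Local Open Scope classical_set_scope.
Local Open Scope ring_scope.

Section power_measure.
Local Open Scope ereal_scope.
Context d (T : measurableType d) (R : realType).

Definition cons_pair n (x : T * n.-tuple T) : n.+1.-tuple T :=
  [tuple of x.1 :: x.2].

Lemma measurable_cons_pair n : measurable_fun setT (@cons_pair n).
Proof. exact: measurable_cons. Qed.

Definition cons_measure n (m : {sigma_finite_measure set T -> \bar R})
    (mn : {measure set (n.-tuple T) -> \bar R}) : set (n.+1.-tuple T) -> \bar R :=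
  pushforward (m \x^ mn) (@cons_pair n).

Section cons_measure_is_measure.
Context n (m : {sigma_finite_measure set T -> \bar R})
  (mn : {measure set (n.-tuple T) -> \bar R}).

Let cons_measure0 : cons_measure m mn set0 = 0.
Proof. by rewrite /cons_measure /pushforward preimage_set0 measure0. Qed.

Let cons_measure_ge0 A : 0 <= cons_measure m mn A.
Proof. exact: integral_ge0. Qed.

Let cons_measure_sigma_additive : semi_sigma_additive (cons_measure m mn).
Proof.
move=> F mF tF mUF; rewrite /cons_measure /pushforward preimage_bigcup.
have mc (A : set (n.+1.-tuple T)) :
    measurable A -> measurable (@cons_pair n @^-1` A).
  by move=> mA; rewrite -[X in measurable X]setTI; exact: measurable_cons_pair.
apply: measure_semi_sigma_additive => [i||]; first exact: mc.
- apply/trivIsetP => /= i j _ _ ij; rewrite -preimage_setI.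
  by move/trivIsetP : tF => /(_ _ _ _ _ ij) ->//; rewrite preimage_set0.
- by rewrite -preimage_bigcup; exact: mc.
Qed.

HB.instance Definition _ := isMeasure.Build _ _ _
  (cons_measure m mn) cons_measure0 cons_measure_ge0 cons_measure_sigma_additive.

End cons_measure_is_measure.

(* The n-fold product measure, characterized by [power_measureE]. *)
Fixpoint power_measure (m : {sigma_finite_measure set T -> \bar R}) n :
    {measure set (n.-tuple T) -> \bar R} :=
  match n with
  | 0 => \d_[tuple]
  | n'.+1 => cons_measure m (power_measure m n')
  end.

Lemma power_measureE (m : {sigma_finite_measure set T -> \bar R}) n
    (A : 'I_n -> set T) : (forall i, measurable (A i)) ->
  power_measure m n [set x | forall i, A i (tnth x i)] = \prod_(i < n) m (A i).
Proof.
elim: n A => [|n IH] A mA.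
  by rewrite big_ord0 /= diracE mem_set// => -[].
rewrite big_ord_recl -IH//= /cons_measure /pushforward.
set B := [set x : n.-tuple T | _].
have mB : measurable B.
  rewrite (_ : B = \bigcap_(i in [set: 'I_n])
      ((fun x : n.-tuple T => tnth x i) @^-1` A (lift ord0 i))).
    apply: fin_bigcap_measurable => // i _.
    by rewrite -[X in measurable X]setTI; exact: measurable_tnth.
  by apply/seteqP; split => x Bx i => [_|]; exact: Bx.
rewrite -product_measure2E//; congr (product_measure2 _ _ _).
apply/seteqP; split => -[x t] /=.
  move=> h; split=> [|i]; first exact: (h ord0).
  by have := h (lift ord0 i); rewrite tnthS.
move=> -[Ax Bt] i; case: (unliftP ord0 i) => [j|] -> //.
by rewrite tnthS; exact: Bt.
Qed.

End power_measure.

Section cube.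
Context (R : realType) (d : nat).

(* R^d with its Borel sigma-algebra *)
Definition Rspace := d.-tuple (measurableTypeR R).

Definition lebesgue : {measure set Rspace -> \bar R} :=
  power_measure (@lebesgue_measure R) d.

Definition cube : set Rspace := [set x | forall j, 0 <= tnth x j < 1].

Lemma measurable_cube : measurable cube.
Proof.
rewrite (_ : cube = \bigcap_(j in [set: 'I_d])
    ((fun x : Rspace => tnth x j) @^-1` `[0, 1[%classic)).
  apply: fin_bigcap_measurable => // j _.
  rewrite -[X in measurable X]setTI.
  by apply: (@measurable_tnth _ (measurableTypeR R)) => //; exact: measurable_itv.
apply/seteqP; split => x cx j => [_|]; rewrite /=; last first.
  by have := cx j I; rewrite /= in_itv.
by rewrite in_itv; exact: cx.
Qed.

Lemma lebesgue_cube : lebesgue cube = 1%E.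
Proof.
pose I01 : set (measurableTypeR R) := [set` `[(0 : R), 1[%R].
have -> : cube = [set x | forall j, I01 (tnth x j)].
  by apply/seteqP; split => x cx j; have := cx j; rewrite /I01 /= in_itv.
have mI01 : measurable I01 by exact: measurable_itv.
rewrite /lebesgue (power_measureE (@lebesgue_measure R) (fun _ : 'I_d => mI01)).
rewrite big1// => i _.
by rewrite [LHS]lebesgue_measure_itv/= lte_fin ltr01 oppr0 adde0.
Qed.

(* Only the values on the cube matter: [pdf] is otherwise arbitrary. *)
Record density := Density {
  pdf :> Rspace -> R;
  measurable_pdf : measurable_fun cube pdf;
  pdf_ge0 : forall x, cube x -> 0 <= pdf x;
  integral_pdf : (\int[lebesgue]_(x in cube) (pdf x)%:E = 1)%E }.

Definition L1dist (f g : Rspace -> R) : \bar R :=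
  (\int[lebesgue]_(x in cube) (`|f x - g x|)%:E)%E.

Section law.
Local Open Scope ereal_scope.
Variable p : density.

Definition law : set Rspace -> \bar R :=
  fun A => \int[lebesgue]_(x in A `&` cube) (p x)%:E.

Let law0 : law set0 = 0.
Proof. by rewrite /law set0I integral_set0. Qed.

Let law_ge0 A : 0 <= law A.
Proof. by apply: integral_ge0 => x [_ cx]; rewrite lee_fin pdf_ge0. Qed.

Let law_sigma_additive : semi_sigma_additive law.
Proof.
move=> F mF tF mUF; rewrite /law; apply: cvg_toP.
  apply: ereal_nondecreasing_is_cvgn => m n mn.
  by apply: lee_sum_nneg_natr => // k _ _; exact: law_ge0.
rewrite setI_bigcupl ge0_integral_bigcup//=.
- by move=> k; apply: measurableI => //; exact: measurable_cube.
- apply/measurable_EFinP; apply: (measurable_funS measurable_cube).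
    by move=> x [k _ []].
  exact: measurable_pdf.
- by move=> x [k _ [_ cx]]; rewrite lee_fin pdf_ge0.
- apply/trivIsetP => /= i j _ _ ij.
  by move/trivIsetP : tF => /(_ i j I I ij) Fij; rewrite setIACA Fij set0I.
Qed.

HB.instance Definition _ := isMeasure.Build _ _ _ law
  law0 law_ge0 law_sigma_additive.

Let law_setT : law setT = 1.
Proof. by rewrite /law setTI integral_pdf. Qed.

HB.instance Definition _ := Measure_isProbability.Build _ _ _ law law_setT.

End law.

Definition iid_law (p : density) (n : nat) :
    {measure set (n.-tuple Rspace) -> \bar R} :=
  power_measure (law p) n.

End cube.

Definition simplex (R : realType) (m : nat) : set ('I_m -> R) :=
  [set a | (forall i, 0 <= a i) /\ \sum_(i < m) a i = 1].

Definition conv_hull (R : realType) (T : Type) (A : set (T -> R)) :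
    set (T -> R) :=
  [set f | exists (m : nat) (a : 'I_m -> R) (g : 'I_m -> T -> R),
    [/\ simplex a, (forall i, A (g i))
      & f = fun x => \sum_(i < m) a i * g i x]].

(* bins are numbered from 0, so that bin i is [i/b, (i+1)/b) *)
Definition bin_density (R : realType) (b : nat) (i : 'I_b) : R -> R :=
  fun x => b%:R * \1_`[i%:R / b%:R, i.+1%:R / b%:R[%classic x.

Definition histogram1 (R : realType) (b : nat) : set (R -> R) :=
  conv_hull (range (@bin_density R b)).

(* The elements vanish outside of the cube. *)
Definition multiview (R : realType) (d b k : nat) : set (Rspace R d -> R) :=
  [set f | exists (w : 'I_k -> R) (p : 'I_k -> 'I_d -> R -> R),
    [/\ simplex w, (forall i j, histogram1 b (p i j))
      & f = fun x => \sum_(i < k) w i * \prod_(j < d) p i j (tnth x j)]].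
Arguments multiview : clear implicits.

(* Measurability of the distances to all densities is what gives a meaning to
   the probabilities of the events [L1dist (V X) p > c]. *)
Definition estimator (R : realType) (d n : nat) (H : set (Rspace R d -> R))
    (V : n.-tuple (Rspace R d) -> Rspace R d -> R) : Prop :=
  (forall X, H (V X)) /\
  (forall p : density R d, measurable_fun setT (fun X => L1dist (V X) p)).

(* Main.v *)
Require Import Defs.
From mathcomp Require Import all_boot all_order all_algebra.
From mathcomp Require Import all_classical all_reals all_analysis.
From mathcomp Require Import measurable_realfun.
From mathcomp Require Import lra ring zify.

Import Order.TTheory GRing.Theory Num.Theory.
Import numFieldNormedType.Exports.

Local Open Scope classical_set_scope.
Local Open Scope ring_scope.

(** A multi-view histogram can hide about [k * b / 2] independent bits, each
  of which leaves a trace in the sample only if some point falls into a region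
  reserved for it; with [n] much smaller than [b * k] most bits stay hidden,
  and no estimator can guess them.

  Take two coordinates [j0] and [j1].  For [i < k] and [l < b/2], the bit of
  the pair [(i, l)] is encoded by a unit mass, spread uniformly over a box of
  side [1/b], whose bin along [j0] is [i] and whose bin along [j1] is [2l] or
  [2l + 1] according to the bit; along the other coordinates the bin is always
  the first one.  The average of these masses is, for each word of bits, a
  multi-view histogram ([mixture_grid_multiview]): its [i]-th component is the
  bin [i] along [j0] times a histogram along [j1].  So the minimum in the
  statement vanishes, and a good estimator would have to come close to the
  density itself.

  A sample of size [n] meets at most [n] of the pairs of boxes
  ([card_unseen]).  Among the samples that leave a given set of bits
  unseen, flipping these bits does not change the law
  ([power_measure_agree]), yet it moves the density far away: when [2n] is
  at most the number of bits, the two densities are at distance at least 1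
  ([L1dist_dens_ge]), so that the estimate is further than 1/4 from one of
  them.  As the flip is an involution, averaging over all words shows that
  the estimator errs with probability at least 1/2 on some word
  ([hidden_bits], [learning_fails]).  This holds for all large [n], which
  contradicts uniform convergence with [eps = 1/4]. *)

(** * Power measures *)

Section power_measure_facts.
Local Open Scope ereal_scope.
Context {disp} {T : measurableType disp} {R : realType}.

Lemma power_measureT (m : {sigma_finite_measure set T -> \bar R}) n :
  m setT = 1 -> power_measure m n setT = 1.
Proof.
move=> m1.
have := @power_measureE _ _ _ m n (fun=> setT) (fun=> measurableT).
rewrite (_ : [set x | _] = setT); last by apply/seteqP; split.
by move=> ->; rewrite big1.
Qed.

Lemma measurable_box n (A : 'I_n -> set T) : (forall i, measurable (A i)) ->
  measurable [set X : n.-tuple T | forall i, A i (tnth X i)].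
Proof.
move=> mA; rewrite (_ : [set X | _] = \bigcap_(i in [set: 'I_n])
    ((fun X : n.-tuple T => tnth X i) @^-1` A i)).
  apply: fin_bigcap_measurable => // i _.
  by rewrite -[X in measurable X]setTI; exact: measurable_tnth.
by apply/seteqP; split => x Bx i => [_|]; exact: Bx.
Qed.

(** The law of a sample, restricted to the samples that lie in [B], only
  depends on the restriction to [B] of the law of one point: by Fubini, one
  coordinate can be exchanged at a time. *)
Lemma power_measure_agree (m1 m2 : {sigma_finite_measure set T -> \bar R})
    (B : set T) : measurable B ->
    (forall A, measurable A -> A `<=` B -> m1 A = m2 A) ->
  forall n (A : set (n.-tuple T)), measurable A ->
    A `<=` [set X | forall i, B (tnth X i)] ->
    power_measure m1 n A = power_measure m2 n A.
Proof.
move=> mB m12; elim=> [//|n IH] A mA AB /=.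
rewrite /cons_measure /pushforward /product_measure2.
set A' := @cons_pair disp T n @^-1` A.
have mA' : measurable A'.
  by rewrite -[X in measurable X]setTI; exact: measurable_cons_pair.
have secB y : ysection A' y `<=` B.
  move=> x; rewrite /ysection/= inE => /AB/(_ ord0).
  by rewrite (tnth_nth x).
transitivity (\int[power_measure m1 n]_x (m2 \o ysection A') x).
  apply: eq_integral => y _ /=; apply: m12 => //.
  exact: measurable_ysection.
have restr : m2 \o ysection A' =
    (m2 \o ysection A') \_ [set X | forall i, B (tnth X i)].
  apply/funext => y; rewrite patchE; case: ifPn => // yB /=.
  rewrite (_ : ysection A' y = set0) ?measure0//.
  apply/seteqP; split=> // x; rewrite /ysection/= inE => /AB h.
  move: yB; rewrite notin_setE => yB; case: yB => i.
  by have := h (lift ord0 i); rewrite tnthS.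
rewrite restr -!integral_mkcond.
apply: eq_measure_integral => Z mZ ZB; exact: IH.
Qed.

End power_measure_facts.

Section finite_partition.
Local Open Scope ereal_scope.
Context {disp} {T : measurableType disp} {R : realType} {I : finType}.

Lemma measure_partition (mu : {measure set T -> \bar R}) (F : T -> I)
    (A : set T) : (forall u, measurable (F @^-1` [set u])) -> measurable A ->
  mu A = \sum_(u : I) mu (A `&` F @^-1` [set u]).
Proof.
move=> mF mA.
rewrite (fsbig_seq _ _ (index_enum_uniq I)).
rewrite -(@measure_fin_bigcup _ _ _ mu)//.
- congr (mu _); apply/seteqP; split => [x Ax|x [u _ []]//].
  by exists (F x) => //=; exact: mem_index_enum.
- by move=> u v _ _ [x [[_ /= <-] [_ /= <-]]].
- by move=> u _; exact: measurableI.
Qed.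

End finite_partition.

(** * Bits that the sample does not see *)

Section hidden_bits.
Local Open Scope ereal_scope.
Context {disp} {T : measurableType disp} {R : realType} {C : finType}.
Variables (N : C -> set T) (n : nat).

Definition unseen (X : n.-tuple T) : {set C} :=
  [set c | `[< forall t, ~ N c (tnth X t) >]]%SET.

Lemma unseenP X c : reflect (forall t, ~ N c (tnth X t)) (c \in unseen X).
Proof. by rewrite inE; exact: asboolP. Qed.

Lemma measurable_unseen u : (forall c, measurable (N c)) ->
  measurable (unseen @^-1` [set u]).
Proof.
move=> mN.
rewrite (_ : _ @^-1` _ = \bigcap_(c in [set: C])
    [set X | (c \in unseen X) = (c \in u)]); last first.
  apply/seteqP; split => [X /= <- //|X /= h].
  by apply/setP => c; exact: h.
apply: fin_bigcap_measurable => // c _.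
have mE : measurable [set X | c \in unseen X].
  rewrite (_ : [set X | _] =
      [set X : n.-tuple T | forall t, (~` N c) (tnth X t)]).
    by apply: (measurable_box n (fun=> ~` N c)) => t; exact: measurableC.
  by apply/seteqP; split => X /= /unseenP.
case: (c \in u); first exact: mE.
rewrite (_ : [set X | _] = ~` [set X | c \in unseen X]); first exact: measurableC.
by apply/seteqP; split => X /= /negP; rewrite /= ?negbK// => /negbTE.
Qed.

(** Since the regions are disjoint, each point of the sample sees at most one
  bit. *)
Lemma card_unseen X : trivIset setT N -> (#|C| <= #|unseen X| + n)%N.
Proof.
move=> tN; rewrite -(cardsC (unseen X)) leq_add2l.
pose f (t : 'I_n) := [pick c | `[< N c (tnth X t) >]].
have sI : injective (@Some C) by move=> ? ? [].
rewrite -(card_imset _ sI).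
apply: (@leq_trans #|f @: 'I_n|); last first.
  by rewrite (leq_trans (leq_imset_card _ _))// card_ord.
apply/subset_leq_card/fintype.subsetP => _ /imsetP[c cX ->].
have /existsNP[t /contrapT Nt] : ~ forall t, ~ N c (tnth X t).
  by apply/unseenP; move: cX; rewrite finset.in_setC.
apply/imsetP; exists t => //; rewrite /f; case: pickP => [c' /asboolP Nt'|].
  by rewrite (tN c c' I I)//; exists (tnth X t).
by move=> /(_ c) /asboolP.
Qed.

Definition flip (u : {set C}) (s : {ffun C -> bool}) : {ffun C -> bool} :=
  [ffun c => (c \in u) (+) s c].

Lemma flipK u : involutive (flip u).
Proof. by move=> s; apply/ffunP => c; rewrite !ffunE addbA addbb. Qed.

(** The averaging argument.  The word [s] of bits determines the law [m s] of
  one point, the bit [c] influences it inside of the region [N c] only, and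
  [A s] is the event that the statistician fails when the word is [s].  Split
  the samples according to the set [u] of the bits that they do not see.  On
  each part, [s] and [flip u s] give the same law, and at least one of the
  corresponding events occurs; summing over all words, where the flip is a
  bijection, the average of the probabilities of failure is at least 1/2. *)
Lemma hidden_bits (m : {ffun C -> bool} -> {sigma_finite_measure set T -> \bar R})
    (A : {ffun C -> bool} -> set (n.-tuple T)) :
  (forall c, measurable (N c)) -> trivIset setT N ->
  (forall s, m s setT = 1) ->
  (forall (s s' : {ffun C -> bool}) B, measurable B ->
     (forall c x, B x -> N c x -> s c = s' c) -> m s B = m s' B) ->
  (forall s, measurable (A s)) ->
  (forall s s' : {ffun C -> bool}, (#|C| <= #|[set c | s c != s' c]%SET| + n)%N ->
     A s `|` A s' = setT) ->
  exists s, (2^-1)%:E <= power_measure (m s) n (A s).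
Proof.
move=> mN tN m1 agree mA cover.
pose P s := power_measure (m s) n.
pose E u := unseen @^-1` [set u].
have mE u : measurable (E u) by exact: measurable_unseen.
pose BU (u : {set C}) := [set x | forall c, c \in u -> ~ N c x].
have mBU u : measurable (BU u).
  rewrite (_ : BU u = \bigcap_(c in [set c | c \in u]) ~` N c) //.
  by apply: fin_bigcap_measurable => // c _; exact: measurableC.
have swap s u D : measurable D -> D `<=` E u -> P s D = P (flip u s) D.
  move=> mD DE; apply: (power_measure_agree _ _ _ (mBU u)) => //; last first.
    by move=> X /DE/= <- i c /unseenP; exact.
  move=> B mB BU_; apply: agree => // c x /BU_ Bx Nx.
  rewrite ffunE; case: (boolP (c \in u)) => [/Bx//|//].
have key s u :
    P s (E u) <= P s (A s `&` E u) + P (flip u s) (A (flip u s) `&` E u).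
  rewrite -(swap s u); [|exact: measurableI|by move=> ? []].
  have [h|h] := leqP #|C| (#|u| + n).
    (* [s] and [flip u s] differ exactly on [u], so the two error events cover. *)
    have EU : E u = (A s `&` E u) `|` (A (flip u s) `&` E u).
      rewrite -setIUl cover ?setTI//.
      rewrite (_ : [set c | _]%SET = u)//; apply/setP => c.
      by rewrite !inE ffunE; case: (c \in u); case: (s c).
    rewrite [X in P s X <= _]EU.
    by apply: measureU2; exact: measurableI.
  rewrite (_ : E u = set0) ?measure0 ?adde_ge0//.
  by apply/seteqP; split => // X /= Xu; have := card_unseen X tN; rewrite Xu leqNgt h.
have sum1 : \sum_(s : {ffun C -> bool}) 1 <= \sum_s (P s (A s) + P s (A s)).
  have PA : \sum_s P s (A s) = \sum_s \sum_u P s (A s `&` E u).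
    by apply: eq_bigr => s _; exact: measure_partition.
  have PAflip : \sum_s P s (A s) =
      \sum_s \sum_u P (flip u s) (A (flip u s) `&` E u).
    rewrite PA exchange_big [RHS]exchange_big/=; apply: eq_bigr => u _.
    by rewrite (reindex_inj (can_inj (flipK u))).
  rewrite big_split/= [X in X + _]PA PAflip -big_split/=.
  apply: lee_sum => s _.
  rewrite -(power_measureT _ n (m1 s)) (measure_partition _ _ _ mE measurableT).
  by rewrite -big_split/=; apply: lee_sum => u _; rewrite setTI; exact: key.
apply/not_existsP => small.
have : \sum_s (P s (A s) + P s (A s)) < \sum_(s : {ffun C -> bool}) 1.
  have half s : P s (A s) = (fine (P s (A s)))%:E /\ (fine (P s (A s)) < 2^-1)%R.
    have lt2 : P s (A s) < (2^-1)%:E by rewrite ltNge; apply/negP => /small.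
    have fP : P s (A s) \is a fin_num.
      by rewrite ge0_fin_numE// (lt_trans lt2)// ltry.
    by rewrite -lte_fin fineK.
  under eq_bigr => s _ do rewrite (half s).1 -EFinD.
  rewrite !sumEFin lte_fin; apply: ltr_sum => [|s _].
    by apply/hasP; exists [ffun=> false]; rewrite ?mem_index_enum.
  by have := (half s).2; lra.
by rewrite ltNge sum1.
Qed.

End hidden_bits.

(** * Uniform densities on grid cells *)

Section cells.
Context {R : realType} {d b : nat}.
Hypothesis b_gt0 : (0 < b)%N.

Let bR_gt0 : 0 < b%:R :> R. Proof. by rewrite ltr0n. Qed.

Definition bin (i : 'I_b) : set (measurableTypeR R) :=
  `[i%:R / b%:R, i.+1%:R / b%:R[%classic.

Lemma measurable_bin i : measurable (bin i).
Proof. exact: measurable_itv. Qed.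

Lemma binP i x : bin i x <-> i%:R <= b%:R * x < i.+1%:R.
Proof.
rewrite /bin /= in_itv/= ler_pdivrMr// ltr_pdivlMr//.
by rewrite [x * _]mulrC.
Qed.

Lemma bin_inj i i' x : bin i x -> bin i' x -> i = i'.
Proof.
move=> /binP/andP[l1 u1] /binP/andP[l2 u2]; apply/val_inj/eqP => /=.
have := le_lt_trans l1 u2; have := le_lt_trans l2 u1.
by rewrite !ltr_nat !ltnS eqn_leq => -> ->.
Qed.

Lemma bin_sub01 i x : bin i x -> 0 <= x < 1.
Proof.
move=> /binP/andP[l u]; rewrite -(ler_pM2l bR_gt0) -(ltr_pM2l bR_gt0).
rewrite mulr0 mulr1 (le_trans _ l)//= (lt_le_trans u)//.
by rewrite ler_nat.
Qed.

Lemma lebesgue_bin i : lebesgue_measure (bin i) = (b%:R^-1)%:E :> \bar R.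
Proof.
rewrite /bin [LHS]lebesgue_measure_itv/= lte_fin ltr_pM2r ?invr_gt0// ltr_nat.
by rewrite ltnSn -EFinD -mulrBl -natrB// subSnn mul1r.
Qed.

Definition cell (a : 'I_d -> 'I_b) : set (Rspace R d) :=
  [set x | forall j, bin (a j) (tnth x j)].

Lemma measurable_cell a : measurable (cell a).
Proof.
by apply: (measurable_box d (fun j => bin (a j))) => j; exact: measurable_bin.
Qed.

Lemma cell_sub_cube a : cell a `<=` @cube R d.
Proof. by move=> x ax j; exact: bin_sub01 (ax j). Qed.

Lemma cell_inj a a' x : cell a x -> cell a' x -> a =1 a'.
Proof. by move=> ax a'x j; exact: bin_inj (ax j) (a'x j). Qed.

Lemma lebesgue_cell a : (lebesgue R d (cell a) = (b%:R ^- d)%:E)%E.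
Proof.
rewrite /lebesgue (power_measureE (@lebesgue_measure R)
  (fun j => measurable_bin (a j))).
rewrite (eq_bigr _ (fun j _ => lebesgue_bin (a j))).
by rewrite prodEFin prodr_const card_ord exprVn.
Qed.

Definition cell_density (a : 'I_d -> 'I_b) (x : Rspace R d) : R :=
  \prod_(j < d) bin_density (a j) (tnth x j).

Lemma cell_densityE a x : cell_density a x = b%:R ^+ d * \1_(cell a) x.
Proof.
rewrite /cell_density /bin_density big_split/= prodr_const card_ord.
congr (_ * _); rewrite [RHS]indicE.
have [|] := boolP (x \in cell a).
  rewrite inE => ax; rewrite big1// => j _.
  by rewrite indicE mem_set//; exact: ax.
rewrite notin_setE => /existsNP[j nj].
by rewrite (bigD1 j)//= indicE memNset ?mul0r.
Qed.

Lemma cell_density_ge0 a x : 0 <= cell_density a x.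
Proof. by rewrite cell_densityE mulr_ge0// exprn_ge0. Qed.

Lemma cell_density_out a x : ~ cell a x -> cell_density a x = 0.
Proof. by move=> nax; rewrite cell_densityE indicE memNset// mulr0. Qed.

Lemma measurable_cell_density D a : measurable_fun D (cell_density a).
Proof.
rewrite (_ : cell_density a = fun x => b%:R ^+ d * \1_(cell a) x).
  apply: measurable_funM => //; apply: measurable_indic; exact: measurable_cell.
by apply/funext => x; rewrite cell_densityE.
Qed.

Lemma integral_cell_density a :
  (\int[lebesgue R d]_(x in @cube R d) (cell_density a x)%:E = 1)%E.
Proof.
under eq_integral do rewrite cell_densityE EFinM.
rewrite ge0_integralZl//.
- rewrite integral_indic//; [|exact: measurable_cube|exact: measurable_cell].
  rewrite setIidl; last exact: cell_sub_cube.
  by rewrite lebesgue_cell -EFinM mulfV// expf_neq0// lt0r_neq0.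
- exact: measurable_cube.
- by apply/measurable_EFinP/measurable_indic; exact: measurable_cell.
Qed.

Lemma integral_sum_cell_density (I : Type) (s : seq I) (a : I -> 'I_d -> 'I_b) :
  (\int[lebesgue R d]_(x in @cube R d) (\sum_(c <- s) cell_density (a c) x)%:E
   = (size s)%:R%:E)%E.
Proof.
under eq_integral do rewrite -sumEFin.
rewrite ge0_integral_sum//.
- under eq_bigr do rewrite integral_cell_density.
  by rewrite sumEFin big_const_seq count_predT iter_addr_0.
- exact: measurable_cube.
- by move=> c; apply/measurable_EFinP; exact: measurable_cell_density.
- by move=> c x _; rewrite lee_fin cell_density_ge0.
Qed.

Section mixture.
Context {C : finType}.
Hypothesis C_gt0 : (0 < #|C|)%N.

Definition mixture (a : C -> 'I_d -> 'I_b) (x : Rspace R d) : R :=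
  #|C|%:R^-1 * \sum_(c : C) cell_density (a c) x.

Lemma measurable_mixture a : measurable_fun (@cube R d) (mixture a).
Proof.
apply: measurable_funM => //.
by apply: measurable_sum => c; exact: measurable_cell_density.
Qed.

Lemma mixture_ge0 a x : @cube R d x -> 0 <= mixture a x.
Proof.
by move=> _; rewrite mulr_ge0// sumr_ge0// => c _; exact: cell_density_ge0.
Qed.

Lemma integral_mixture a :
  (\int[lebesgue R d]_(x in @cube R d) (mixture a x)%:E = 1)%E.
Proof.
under eq_integral do rewrite EFinM.
rewrite ge0_integralZl//.
- rewrite integral_sum_cell_density -EFinM.
  rewrite [index_enum _]unlock -enumT -cardT mulVf// pnatr_eq0 -lt0n //.
- exact: measurable_cube.
- apply/measurable_EFinP; apply: measurable_sum => c.
  exact: measurable_cell_density.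
- by move=> x _; rewrite lee_fin sumr_ge0// => c _; exact: cell_density_ge0.
Qed.

Definition mixture_density a : density R d :=
  Density (measurable_mixture a) (@mixture_ge0 a) (integral_mixture a).

End mixture.
End cells.

(** * The distance L1 and the multi-view histograms *)

Section L1dist_facts.
Context {R : realType} {d : nat}.
Implicit Types f g h : Rspace R d -> R.

Lemma L1dist_triangle f g h : measurable_fun (@cube R d) f ->
  measurable_fun (@cube R d) g -> measurable_fun (@cube R d) h ->
  (L1dist g h <= L1dist f g + L1dist f h)%E.
Proof.
move=> mf mg mh; rewrite /L1dist.
have mdist (u v : Rspace R d -> R) : measurable_fun (@cube R d) u -> measurable_fun (@cube R d) v ->
    measurable_fun (@cube R d) (fun x => (`|u x - v x|)%:E).
  move=> mu mv; apply/measurable_EFinP/measurableT_comp => //.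
  exact: measurable_funB.
rewrite -ge0_integralD//.
- apply: ge0_le_integral => //.
  + exact: measurable_cube.
  + exact: mdist.
  + by apply: emeasurable_funD; exact: mdist.
  + move=> x _; rewrite -EFinD lee_fin.
    rewrite (_ : g x - h x = (f x - h x) - (f x - g x)); last by ring.
    by rewrite [leRHS]addrC ler_normB.
- exact: measurable_cube.
- exact: mdist.
- exact: mdist.
Qed.

Lemma L1distxx f : L1dist f f = 0%E.
Proof.
by rewrite /L1dist; under eq_integral do rewrite subrr normr0; exact: integral0.
Qed.

Lemma L1dist_ge0 f g : (0 <= L1dist f g)%E.
Proof. by apply: integral_ge0 => x _; rewrite lee_fin. Qed.

Lemma inf_L1dist_mem (H : set (Rspace R d -> R)) f : H f ->
  ereal_inf [set L1dist f q | q in H] = 0%E.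
Proof.
move=> Hf; apply/eqP; rewrite eq_le; apply/andP; split.
  by apply: ereal_inf_lbound; exists f => //; exact: L1distxx.
by apply: le_ereal_inf_tmp => _ [q _ <-]; exact: L1dist_ge0.
Qed.

Lemma measurable_histogram1 b (f : R -> R) : histogram1 b f ->
  measurable_fun (setT : set (measurableTypeR R)) f.
Proof.
move=> [m [a [g [_ gb ->]]]]; apply: measurable_sum => i.
apply: measurable_funM => //; have [j _ <-] := gb i.
apply: measurable_funM => //; apply: measurable_indic; exact: measurable_itv.
Qed.

Lemma measurable_multiview b k f : multiview R d b k f ->
  measurable_fun (@cube R d) f.
Proof.
move=> [w [p [_ hp ->]]]; apply: measurable_sum => i.
apply: measurable_funM => //; apply: measurable_prod => j _.
apply: measurable_funTS.
apply: (measurableT_comp (measurable_histogram1 _ _ (hp i j))).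
exact: measurable_tnth.
Qed.

End L1dist_facts.

(** * Families of mixtures indexed by binary words *)

Section binary_family.
Context {R : realType} {d b : nat} {C : finType}.
Hypotheses (b_gt0 : (0 < b)%N) (C_gt0 : (0 < #|C|)%N).
Variable a : C -> bool -> 'I_d -> 'I_b.
Hypothesis a_inj : forall c c' s s', a c s =1 a c' s' -> c = c' /\ s = s'.

Local Notation dens s := (@mixture R d b C (fun c => a c (s c))).
Local Notation cellR := (@cell R d b).

Definition pair_cell c : set (Rspace R d) := cellR (a c true) `|` cellR (a c false).

Lemma measurable_pair_cell c : measurable (pair_cell c).
Proof. by apply: measurableU; exact: measurable_cell. Qed.

Lemma pair_cellP c x : pair_cell c x <-> exists s, cellR (a c s) x.
Proof.
by split=> [[] ?|[[] ?]]; [exists true|exists false|left|right].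
Qed.

Lemma trivIset_pair_cell : trivIset setT pair_cell.
Proof.
move=> c c' _ _ [x [/pair_cellP[s xs] /pair_cellP[s' xs']]].
by have [] := a_inj _ _ _ _ (cell_inj b_gt0 _ _ _ xs xs').
Qed.

Lemma dens_agree (s s' : {ffun C -> bool}) x :
  (forall c, pair_cell c x -> s c = s' c) -> dens s x = dens s' x.
Proof.
move=> ss'; rewrite /mixture; congr (_ * _); apply: eq_bigr => c _.
have [Nc|Nc] := pselect (pair_cell c x); first by rewrite ss'.
by rewrite !cell_density_out// => h; apply: Nc; apply/pair_cellP; eexists; exact: h.
Qed.

Lemma law_agree (s s' : {ffun C -> bool}) B : measurable B ->
  (forall c x, B x -> pair_cell c x -> s c = s' c) ->
  law (mixture_density b_gt0 C_gt0 (fun c => a c (s c))) B =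
  law (mixture_density b_gt0 C_gt0 (fun c => a c (s' c))) B.
Proof.
move=> mB ss'; apply: eq_integral => x; rewrite inE => -[Bx _].
by congr EFin; apply: dens_agree => c; exact: ss'.
Qed.

(** The cells are pairwise disjoint, so at each point at most one of the terms
  of the two mixtures is nonzero and nothing cancels in the difference. *)
Lemma dist_dens_ge (s s' : {ffun C -> bool}) x :
  #|C|%:R^-1 * \sum_(c in [set c | s c != s' c]%SET)
    (cell_density (a c true) x + cell_density (a c false) x) <=
  `|dens s x - dens s' x|.
Proof.
rewrite /mixture -mulrBr -sumrB normrM ger0_norm ?invr_ge0//.
rewrite ler_wpM2l ?invr_ge0//.
have [[c0 /pair_cellP[s0 xs0]]|none] := pselect (exists c, pair_cell c x).
  have out c t : (c, t) != (c0, s0) -> cell_density (a c t) x = 0.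
    move=> ne; apply: cell_density_out => xt.
    have [ec es] := a_inj _ _ _ _ (cell_inj b_gt0 _ _ _ xt xs0).
    by rewrite ec es eqxx in ne.
  have out0 c t : c != c0 -> cell_density (a c t) x = 0.
    by move=> ne; apply: out; rewrite xpair_eqE (negbTE ne).
  rewrite [X in _ <= `|X|](bigD1 c0)//= [X in _ + X]big1 ?addr0; last first.
    by move=> c ne; rewrite !out0// subrr.
  have [c0D|c0D] := boolP (c0 \in [set c | s c != s' c]%SET).
    rewrite (bigD1 c0)//= [X in _ + X]big1 ?addr0; last first.
      by move=> c /andP[_ ne]; rewrite !out0// addr0.
    have := out c0 (~~ s0); move: c0D; rewrite inE xpair_eqE eqxx/=.
    have := @cell_density_ge0 R d b (a c0 s0) x.
    case: s0 {xs0 out} => /= g0; case: (s c0); case: (s' c0) => //= _ -> //;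
      by rewrite ?addr0 ?add0r ?subr0 ?sub0r ?normrN ger0_norm.
  rewrite big1// => c cD; rewrite !out0 ?addr0//;
    by apply: contraNneq c0D => <-.
rewrite big1// => c _.
rewrite !cell_density_out ?addr0// => xc; apply: none; exists c;
  by [left|right].
Qed.

(** Each differing bit moves a mass [1 / #|C|] from one cell to a disjoint one,
  which contributes twice that mass to the distance. *)
Lemma L1dist_dens_ge (s s' : {ffun C -> bool}) :
  ((2 * #|[set c | s c != s' c]%SET|%:R / #|C|%:R)%:E
    <= L1dist (dens s) (dens s'))%E.
Proof.
set D := [set c | s c != s' c]%SET.
have mpair c : measurable_fun (@cube R d) (fun x : Rspace R d =>
    cell_density (a c true) x + cell_density (a c false) x).
  by apply: measurable_funD; exact: measurable_cell_density.
have msum : measurable_fun (@cube R d) (fun x : Rspace R d =>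
    \sum_(c in D) (cell_density (a c true) x + cell_density (a c false) x)).
  under eq_fun do rewrite -big_enum/=.
  exact: measurable_sum.
apply: (@le_trans _ _ (\int[lebesgue R d]_(x in @cube R d)
  (#|C|%:R^-1 * \sum_(c in D)
    (cell_density (a c true) x + cell_density (a c false) x))%:E)%E); last first.
  apply: ge0_le_integral => //.
  - exact: measurable_cube.
  - move=> x _; rewrite lee_fin mulr_ge0 ?invr_ge0// sumr_ge0// => c _.
    by rewrite addr_ge0 ?cell_density_ge0.
  - by apply/measurable_EFinP; apply: measurable_funM.
  - apply/measurable_EFinP/measurableT_comp => //.
    by apply: measurable_funB; exact: measurable_mixture.
  - by move=> x _; rewrite lee_fin; exact: dist_dens_ge.
under eq_integral do rewrite EFinM.
rewrite ge0_integralZl//.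
- under eq_integral do rewrite big_split/= -!big_enum/= EFinD.
  rewrite ge0_integralD//.
  + rewrite !integral_sum_cell_density// -EFinD -EFinM lee_fin.
    by rewrite -cardE mulrC; lra.
  + exact: measurable_cube.
  + by move=> x _; rewrite lee_fin sumr_ge0// => c _; exact: cell_density_ge0.
  + apply/measurable_EFinP; apply: measurable_sum => c.
    exact: measurable_cell_density.
  + by move=> x _; rewrite lee_fin sumr_ge0// => c _; exact: cell_density_ge0.
  + apply/measurable_EFinP; apply: measurable_sum => c.
    exact: measurable_cell_density.
- exact: measurable_cube.
- exact/measurable_EFinP.
- move=> x _; rewrite lee_fin sumr_ge0// => c _.
  by rewrite addr_ge0 ?cell_density_ge0.
Qed.

End binary_family.

(** * A family of multi-view histograms with many bits *)

Section uniform_weights.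
Context {R : realType}.

Lemma simplex_uniform m : (0 < m)%N ->
  simplex (fun _ : 'I_m => m%:R^-1 : R).
Proof.
move=> m0; split=> [i|]; first by rewrite invr_ge0.
by rewrite sumr_const card_ord -[LHS]mulr_natr mulVf// pnatr_eq0 -lt0n.
Qed.

Lemma histogram1_uniform b h (f : 'I_h -> 'I_b) : (0 < h)%N ->
  histogram1 b (fun x : R => \sum_(l < h) h%:R^-1 * bin_density (f l) x).
Proof.
move=> h0; exists h, (fun=> h%:R^-1), (fun l => bin_density (f l)).
by split=> //; exact: simplex_uniform.
Qed.

Lemma histogram1_bin b (i : 'I_b) : histogram1 b (@bin_density R b i).
Proof.
have := @histogram1_uniform b 1 (fun=> i) isT.
by congr histogram1; apply/funext => x; rewrite big_ord1 invr1 mul1r.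
Qed.

End uniform_weights.

Lemma twin_bin_lt {b} (l : 'I_b./2) (s : bool) : (l.*2 + s < b)%N.
Proof. by case: l s => l /= + []; lia. Qed.

Definition twin_bin {b} (l : 'I_b./2) (s : bool) : 'I_b :=
  Ordinal (twin_bin_lt l s).

Section two_view_family.
Context {R : realType} {d b k : nat}.
Variables (j0 j1 : 'I_d).
Hypotheses (j01 : j0 != j1) (kb : (k <= b)%N) (b2 : (2 <= b)%N).

Let b_gt0 : (0 < b)%N. Proof. exact: leq_trans b2. Qed.
Let h_gt0 : (0 < b./2)%N. Proof. by rewrite half_gt0. Qed.

Definition grid_cell (c : 'I_k * 'I_b./2) (s : bool) (j : 'I_d) : 'I_b :=
  if j == j0 then widen_ord kb c.1
  else if j == j1 then twin_bin c.2 s else Ordinal b_gt0.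

Lemma grid_cell_inj c c' s s' : grid_cell c s =1 grid_cell c' s' ->
  c = c' /\ s = s'.
Proof.
move: c c' => [i l] [i' l'] e.
have := e j0; rewrite /grid_cell eqxx/= => /(congr1 val)/= /val_inj ->.
have := e j1; rewrite /grid_cell eq_sym (negbTE j01) eqxx => /(congr1 val)/= el.
have ss' : s = s' by move: el {e}; case: s; case: s'; lia.
by split=> //; congr pair; apply/val_inj => /=; move: el; rewrite ss'; lia.
Qed.

Lemma card_grid : #|{: 'I_k * 'I_b./2}| = (k * b./2)%N.
Proof. by rewrite card_prod !card_ord. Qed.

Lemma card_grid_gt0 : (0 < k)%N -> (0 < #|{: 'I_k * 'I_b./2}|)%N.
Proof. by move=> k_gt0; rewrite card_grid muln_gt0 k_gt0. Qed.

(** The sum over [l] can be moved inside of the factor along [j1], because all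
  cells [(i, l)] with the same [i] have the same bins along the other
  coordinates.  This is what leaves only [k] components for [k * b./2] bits. *)
Lemma mixture_grid_multiview (s : 'I_k * 'I_b./2 -> bool) :
  (0 < k)%N -> multiview R d b k (mixture (fun c => grid_cell c (s c))).
Proof.
move=> k_gt0.
pose p (i : 'I_k) (j : 'I_d) (y : R) : R :=
  if j == j1 then
    \sum_(l < b./2) (b./2)%:R^-1 * bin_density (twin_bin l (s (i, l))) y
  else bin_density (if j == j0 then widen_ord kb i else Ordinal b_gt0) y.
exists (fun=> k%:R^-1), p; split.
- exact: simplex_uniform.
- move=> i j; rewrite /p; case: (j == j1); last by apply: histogram1_bin.
  exact: histogram1_uniform.
apply/funext => x; rewrite /mixture card_grid.
have -> : \sum_c cell_density (grid_cell c (s c)) x =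
    \sum_(i < k) \sum_(l < b./2) cell_density (grid_cell (i, l) (s (i, l))) x.
  by rewrite pair_bigA; apply: eq_bigr => -[].
rewrite mulr_sumr; apply: eq_bigr => i _.
rewrite natrM invfM -mulrA; congr (_ * _); rewrite mulr_sumr.
rewrite (bigD1 j1)//= {1}/p eqxx mulr_suml; apply: eq_bigr => l _.
rewrite -mulrA; congr (_ * _); rewrite /cell_density (bigD1 j1)//=.
rewrite {1}/grid_cell eq_sym (negbTE j01) eqxx; congr (_ * _).
apply: eq_bigr => j jj1; rewrite /p /grid_cell (negbTE jj1).
by case: eqP.
Qed.

End two_view_family.

(** The densities at hand are multi-view histograms, so that the distance of
  the estimate is compared with a constant only.  Every sample leaves at least half
  of the bits unseen, which gives two candidate densities at distance at least 1, and
  [1/4 + 1/4 < 1]. *)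
Lemma learning_fails (R : realType) (d b k n : nat)
    (V : n.-tuple (Rspace R d) -> Rspace R d -> R) :
  (2 <= d)%N -> (2 <= b)%N -> (0 < k)%N -> (k <= b)%N ->
  (2 * n <= k * b./2)%N -> estimator (multiview R d b k) V ->
  exists2 p : density R d, multiview R d b k p &
    ((2^-1)%:E <= iid_law p n [set X | (4^-1)%:E < L1dist (V X) p])%E.
Proof.
move=> d2 b2 k0 kb nM [VH mV].
have d0 : (0 < d)%N by exact: leq_trans d2.
pose j0 := Ordinal d0; pose j1 := Ordinal d2.
have j01 : j0 != j1 by [].
have b0 : (0 < b)%N by exact: leq_trans b2.
pose C : finType := ('I_k * 'I_b./2)%type.
have cardC : #|C| = (k * b./2)%N by exact: card_grid.
have C0 : (0 < #|C|)%N by exact: card_grid_gt0.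
pose a : C -> bool -> 'I_d -> 'I_b := grid_cell j0 j1 kb b2.
have a_inj := grid_cell_inj j0 j1 j01 kb b2.
pose p (s : {ffun C -> bool}) : density R d :=
  mixture_density b0 C0 (fun c => a c (s c)).
have pH s : multiview R d b k (p s) by apply: mixture_grid_multiview.
pose A s := [set X | ((4^-1)%:E < L1dist (V X) (p s))%E].
have mA s : measurable (A s).
  rewrite -[A s]setTI.
  by apply: emeasurable_fun_o_infty => //; exact: mV.
have cover (s s' : {ffun C -> bool}) :
    (#|C| <= #|[set c | s c != s' c]%SET| + n)%N -> A s `|` A s' = setT.
  move=> many; apply/seteqP; split=> // X _.
  have far : (1%:E <= L1dist (p s) (p s'))%E.
    apply: le_trans (L1dist_dens_ge (C := C) b0 a a_inj s s').
    rewrite lee_fin ler_pdivlMr ?ltr0n// mul1r -natrM ler_nat.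
    by move: many nM; rewrite -cardC; lia.
  have tri : (1%:E <= L1dist (V X) (p s) + L1dist (V X) (p s'))%E.
    apply: le_trans far _; apply: L1dist_triangle; try exact: measurable_pdf.
    exact: measurable_multiview (VH X).
  have [|near_s] := boolP ((4^-1)%:E < L1dist (V X) (p s))%E; first by left.
  right; rewrite /A/= ltNge; apply/negP => near_s'.
  move: near_s; rewrite -leNgt => near_s.
  have := le_trans tri (leeD near_s near_s').
  by rewrite -EFinD lee_fin; lra.
have [s hs] := @hidden_bits _ (Rspace R d) R C (pair_cell a) n
  (fun s => law (p s)) A (measurable_pair_cell a)
  (trivIset_pair_cell b0 a a_inj) (fun s => probability_setT (law (p s)))
  (law_agree b0 C0 a) mA cover.
by exists (p s).
Qed.

Theorem theorem2p3 (R : realType) (d : nat) (b k : nat -> nat) :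
  (2 <= d)%N ->
  (forall n, 0 < b n)%N -> (forall n, 0 < k n)%N ->
  b n @[n --> \oo] --> \oo -> k n @[n --> \oo] --> \oo ->
  (forall n, k n <= b n)%N ->
  (n%:R / (b n * k n)%:R : R) @[n --> \oo] --> (0 : R) ->
  ~ exists V : forall n, n.-tuple (Rspace R d) -> Rspace R d -> R,
      (forall n, estimator (multiview R d (b n) (k n)) (V n)) /\
      forall eps : R, 0 < eps ->
        ereal_sup [set iid_law p n
            [set X | (3%:E * ereal_inf [set L1dist p q
                                       | q in multiview R d (b n) (k n)]
                      + eps%:E < L1dist (V n X) p)%E]
          | p in [set: density R d]] @[n --> \oo] --> 0%E.
Proof.
move=> d2 b0 k0 boo _ kb nbk [V [VH Vlearn]].
have b2 : \forall n \near \oo, (2 <= b n)%N by exact: boo (nbhs_infty_ge 2).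
have few : \forall n \near \oo, (n%:R / (b n * k n)%:R : R) < 8^-1.
  by apply: (cvgr_lt _ nbk); rewrite invr_gt0.
have eps0 : 0 < 4^-1 :> R by rewrite invr_gt0.
have := Vlearn _ eps0; set risk := fun n => ereal_sup _ => risk0.
have small : \forall n \near \oo, (risk n < (2^-1)%:E)%E.
  have : (0%:E < (2^-1)%:E :> \bar R)%E by rewrite lte_fin invr_gt0.
  move=> /open_ereal_lt'; exact: risk0.
near \oo => n.
have bn2 : (2 <= b n)%N by near: n.
have nM : (2 * n <= k n * (b n)./2)%N.
  have : (n%:R / (b n * k n)%:R : R) < 8^-1 by near: n.
  rewrite ltr_pdivrMr ?ltr0n ?muln_gt0 ?b0 ?k0// mulrC ltr_pdivlMr//.
  rewrite -natrM ltr_nat => few_n.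
  (* The bound on [n] is in terms of [b], and [b./2 >= b / 3] once [b >= 2]. *)
  have half_b : (b n <= 3 * (b n)./2)%N by lia.
  by have := leq_mul (leqnn (k n)) half_b; lia.
have [p pH] := learning_fails _ _ _ _ _ _ d2 bn2 (k0 n) (kb n) nM (VH n).
apply/negP; rewrite -ltNge.
have : (risk n < (2^-1)%:E)%E by near: n.
apply: le_lt_trans; apply: ereal_sup_ubound; exists p => //.
by rewrite inf_L1dist_mem// mule0 add0e.
Unshelve. all: by end_near.
Qed.
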